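(* Let $m>n\ge 2$ be integers and let $G_{m\times n}$ be the $m\times n$ heteromorphic two-dimensional magic cube group. Then $$|G_{m\times n}|=\begin{cases}(mn)!/2, & mn\equiv 1 \pmod 2,\\ (mn)!, & mn\equiv 0 \pmod 2.\end{cases}$$
   Context: Consider a rectangular board with $n$ rows and $m$ columns, whose positions are numbered $1,2,\dots,mn$ from top to bottom and left to right: the position in row $x$ and column $y$ ($1\le x\le n$, $1\le y\le m$) has number $\varphi(x,y)=m(x-1)+y$. Permutations act on the right and are composed from left to right. For $j\in\mathbb{Z}$ define the permutations of $\{1,\dots,mn\}$ $$V_i^j=\bigl(\varphi(n,i)\ \varphi(n-1,i)\ \cdots\ \varphi(1,i)\bigr)^j\ (1\le i\le m),\qquad H_i^j=\bigl(\varphi(i,m)\ \varphi(i,m-1)\ \cdots\ \varphi(i,1)\bigr)^j\ (1\le i\le n),$$ i.e. cyclic shifts by $j$ steps of column $i$ (upwards) and of row $i$ (leftwards). $G_{m\times n}$ is the set of all permutations that are finite compositions of the $V_i^j$ and $H_i^j$; it is a group under composition. *)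

(* Defs.v *)
From mathcomp Require Import all_boot all_fingroup ssrint.

Set Implicit Arguments.
Unset Strict Implicit.
Unset Printing Implicit Defensive.

Local Open Scope group_scope.

(** The cycle [(a_1 a_2 ... a_k)] written as the duplicate-free sequence
    [:: a_1; a_2; ...; a_k]: it maps [a_l] to [a_(l+1)], [a_k] to [a_1], and
    fixes every other point. *)
Definition cycle_perm (T : finType) (c : seq T) (Uc : uniq c) : {perm T} :=
  perm (can_inj (prev_next Uc)).

Section Board.

(* [m] columns and [n] rows, in this order. *)
Variables m n : nat.

Lemma position_subproof (x : 'I_n) (y : 'I_m) : (m * x + y < m * n)%N.
Proof.
have lexn : (m * x.+1 <= m * n)%N by rewrite leq_mul2l ltn_ord orbT.
by apply: leq_trans lexn; rewrite mulnS addnC ltn_add2r ltn_ord.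
Qed.

(** Rows, columns and positions are counted from 0, so the position in row
    [x.+1] and column [y.+1], numbered [m * x + y.+1] when counting from 1, is
    the ordinal [m * x + y]. *)
Definition position (x : 'I_n) (y : 'I_m) : 'I_(m * n) :=
  Ordinal (position_subproof x y).

Lemma position_inj (x x' : 'I_n) (y y' : 'I_m) :
  position x y = position x' y' -> x = x' /\ y = y'.
Proof.
move=> /(congr1 val) /= e.
have m_gt0 : (0 < m)%N by apply: leq_ltn_trans (ltn_ord y).
split; apply: val_inj => /=.
  have := congr1 (divn^~ m) e; rewrite /= ![(m * _)%N]mulnC.
  by rewrite !divnMDl // !divn_small // !addn0.
have := congr1 (modn^~ m) e; rewrite /= ![(m * _)%N]mulnC.
by rewrite !modnMDl !modn_small.
Qed.

(** The sequence runs over the column from bottom to top (and below, over the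
    row from right to left), so that the cycle moves upwards (resp.
    leftwards). *)
Definition column_cycle (i : 'I_m) : seq 'I_(m * n) :=
  [seq position x i | x <- rev (enum 'I_n)].

Definition row_cycle (i : 'I_n) : seq 'I_(m * n) :=
  [seq position i y | y <- rev (enum 'I_m)].

Lemma column_cycle_uniq (i : 'I_m) : uniq (column_cycle i).
Proof.
rewrite map_inj_uniq ?rev_uniq ?enum_uniq // => x x' e.
by case: (position_inj e).
Qed.

Lemma row_cycle_uniq (i : 'I_n) : uniq (row_cycle i).
Proof.
rewrite map_inj_uniq ?rev_uniq ?enum_uniq // => y y' e.
by case: (position_inj e).
Qed.

Definition column_shift (i : 'I_m) : {perm 'I_(m * n)} :=
  cycle_perm (column_cycle_uniq i).

Definition row_shift (i : 'I_n) : {perm 'I_(m * n)} :=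
  cycle_perm (row_cycle_uniq i).

(** [<[g]>] is the set of all powers of [g], with exponent in Z. *)
Definition moves : {set {perm 'I_(m * n)}} :=
  (\bigcup_(i < m) <[column_shift i]>) :|: (\bigcup_(i < n) <[row_shift i]>).

Definition magic_cube_group : {group {perm 'I_(m * n)}} := <<moves>>%G.

(** Explicit form of the elements of the group, as finite compositions of
    integer powers of column and row shifts.  The product of permutations
    composes from left to right. *)
Definition zpow (g : {perm 'I_(m * n)}) (j : int) : {perm 'I_(m * n)} :=
  match j with Posz k => g ^+ k | Negz k => g ^- k.+1 end.

Definition move_perm (a : ('I_m + 'I_n) * int) : {perm 'I_(m * n)} :=
  match a.1 with inl i => zpow (column_shift i) a.2 | inr i => zpow (row_shift i) a.2 end.

Lemma mem_magic_cube_group (s : {perm 'I_(m * n)}) :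
  s \in magic_cube_group <->
  exists w : seq (('I_m + 'I_n) * int), s = \prod_(a <- w) move_perm a.
Proof.
have zpow_mem g j : zpow g j \in <[g]>.
  by case: j => k /=; rewrite ?groupV mem_cycle.
split.
  case/gen_prodgP => k [f fM ->].
  elim: k f fM => [|k IHk] f fM; first by exists [::]; rewrite big_ord0 big_nil.
  rewrite big_ord_recl.
  have [w ->] := IHk (fun i => f (lift ord0 i)) (fun i => fM _).
  have [a ->] : exists a, f ord0 = move_perm a.
    case/setUP: (fM ord0) => /bigcupP [i _ /cycleP [j ->]].
      by exists (inl i, Posz j).
    by exists (inr i, Posz j).
  by exists (a :: w); rewrite big_cons.
case=> w ->; elim: w => [|a w IHw]; first by rewrite big_nil group1.
rewrite big_cons groupM // {w IHw}.
apply: mem_gen; rewrite /move_perm; case: a => [[i|i] j] /=; apply/setUP.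
  by left; apply/bigcupP; exists i => //; apply: zpow_mem.
by right; apply/bigcupP; exists i => //; apply: zpow_mem.
Qed.

End Board.

(* Main.v *)
Require Import Defs.
From mathcomp Require Import all_boot all_fingroup.
From mathcomp Require Import alt.

(** The group contains the alternating group, and it contains an odd
    permutation exactly when one of the side lengths is even; this gives the
    two orders.

    For the first point, take a position p, a power of the shift of its row
    that moves p to q, and a power of the shift of its column that moves p to
    r.  The supports of the two powers meet only in p, so their commutator is
    the product of the transpositions (p q) and (p r)
    ([commutator_two_transpositions]).  In terms of the left cosets of the
    group, (p q) and (p r) lie in the same one ([corner_same_coset]).  Walking
    along corners, all transpositions of two positions in a common row or
    column lie in one coset.  A diagonal transposition is conjugate to such a
    transposition by another one, and this puts it in that coset too
    ([lcoset_tperm_trans]).  When all transpositions lie in one left coset,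
    a product of two of them lies in the group, so the group contains all even
    permutations ([Alt_sub_one_coset]).

    For the second point, a cycle of length k has the parity of k - 1
    ([odd_cycle_perm]), so the row shifts are even permutations when m is odd
    and odd ones when m is even, and likewise for the column shifts with n. *)

Set Implicit Arguments.
Unset Strict Implicit.
Unset Printing Implicit Defensive.

(** * Permutation groups containing the alternating group; parity of cycles *)

Section PermutationGroups.

Local Open Scope group_scope.

Variable T : finType.
Implicit Types (r s : {perm T}) (G : {group {perm T}}).

(** Two permutations whose supports meet only in [p] have as commutator a
    3-cycle through [p] and its two images.  The factored form of the 3-cycle
    compares the two transpositions modulo any group containing both
    permutations. *)
Lemma commutator_two_transpositions r (c : {perm T}) p :
    (forall z, z != p -> r z = z \/ c z = z) -> r p != p -> c p != p ->
  [~ c, r] = tperm p (r p) * tperm p (c p).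
Proof.
move=> rc_fix rp_p cp_p.
have c_rp : c (r p) = r p.
  by case: (rc_fix _ rp_p) => // /perm_inj rp; rewrite rp eqxx in rp_p.
have r_cp : r (c p) = c p.
  by case: (rc_fix _ cp_p) => // /perm_inj cp; rewrite cp eqxx in cp_p.
have rp_cp : r p != c p.
  by apply: contra_neq rp_p => e; apply: (@perm_inj _ c); rewrite c_rp.
(* Moving the inverses to the other side avoids computing preimages. *)
suff eq_cr : c * r = r * c * (tperm p (r p) * tperm p (c p)).
  by rewrite commgEl conjgE eq_cr -mulgA !mulKg.
apply/permP=> z; rewrite !permM.
have [-> | z_p] := eqVneq z p; first by rewrite c_rp r_cp tpermR tpermL.
have out w : w != p -> w != r p -> w != c p ->
    tperm p (c p) (tperm p (r p) w) = w.
  by move=> wp wr wc; rewrite [tperm p (r p) w]tpermD ?tpermD // eq_sym.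
have [rz | cz] := rc_fix z z_p.
  rewrite rz; have [-> | cz_p] := eqVneq (c z) p.
    by rewrite tpermL tpermD 1?eq_sym //.
  have -> : r (c z) = c z by case: (rc_fix _ cz_p) => // /perm_inj ->.
  rewrite out // ?(inj_eq perm_inj) // -c_rp (inj_eq perm_inj).
  by apply: contra_neq z_p => zr; apply: (@perm_inj _ r); rewrite rz.
rewrite cz; have [-> | rz_p] := eqVneq (r z) p.
  by rewrite [tperm p (r p) _]tpermD ?tpermR // eq_sym.
have -> : c (r z) = r z by case: (rc_fix _ rz_p) => // /perm_inj ->.
rewrite out // ?(inj_eq perm_inj) // -r_cp (inj_eq perm_inj).
by apply: contra_neq z_p => zc; apply: (@perm_inj _ c); rewrite cz.
Qed.

Lemma lcoset_eqE G s t : (s *: G == t *: G) = (s^-1 * t \in G).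
Proof.
rewrite -mem_lcoset; apply/eqP/idP => [-> | /lcoset_eqP -> //].
exact: lcoset_refl.
Qed.

(** With [g = (a c)(b c)] in [G], the transposition [(a b) = (b c)(a c)(b c)]
    equals [(a c)] times the square of [g]. *)
Lemma lcoset_tperm_trans G a b c :
    a != b -> a != c -> b != c ->
    tperm a c *: G = tperm c b *: G ->
  tperm a b *: G = tperm a c *: G.
Proof.
move=> ab ac bc /eqP; rewrite lcoset_eqE tpermV => g_in.
apply/esym/eqP; rewrite lcoset_eqE tpermV.
rewrite [tperm c b]tpermC in g_in.
have -> : tperm a b = tperm a c ^ tperm b c.
  by rewrite tpermJ tpermR tpermD 1?eq_sym //.
by rewrite conjgE tpermV mulgA groupM // mulgA.
Qed.

(** If [t] and [t'] are transpositions in one left coset of [G], then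
    [t t' = t^-1 t'] is in [G]; even permutations are products of such
    pairs. *)
Lemma Alt_sub_one_coset G s :
    (forall a b, a != b -> tperm a b *: G = s *: G) ->
  'Alt_T \subset G.
Proof.
move=> one_coset; apply/subsetP=> u; rewrite Alt_even.
have [ts -> ts_dpair] := prod_tpermP u.
suff: \prod_(t <- ts) tperm t.1 t.2 \in
        (if odd (size ts) then s *: G else G).
  rewrite odd_perm_prod //.
  by case: odd.
(* The parity of the number of factors decides between the two cosets. *)
elim: ts ts_dpair => [|[a b] ts IHts] /=; first by rewrite big_nil group1.
case/andP=> /= ab /IHts; rewrite big_cons /=.
case: odd => /=; rewrite -(one_coset _ _ ab) mem_lcoset.
  by rewrite tpermV.
by rewrite tpermV mulgA tperm2 mul1g.
Qed.

Lemma eq_setT_Alt_sub_odd G s :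
  'Alt_T \subset G -> s \in G -> odd_perm s -> G :=: setT.
Proof.
move=> AltG Gs odd_s; apply/setP=> u; rewrite inE.
have [odd_u | even_u] := boolP (odd_perm u); last first.
  by apply: (subsetP AltG); rewrite Alt_even.
rewrite -(groupMr _ Gs); apply: (subsetP AltG).
by rewrite Alt_even odd_permM odd_s odd_u.
Qed.

Lemma cycle_permE (c : seq T) (Uc : uniq c) : cycle_perm Uc =1 next c.
Proof. by move=> z; rewrite permE. Qed.

(** This factorization strips one point off a cycle at the cost of one
    transposition, for the computation of the parity. *)
Lemma cycle_perm_cons2 x y (c : seq T) (Uxyc : uniq [:: x, y & c])
    (Uxc : uniq (x :: c)) :
  cycle_perm Uxyc = tperm x y * cycle_perm Uxc.
Proof.
apply/permP=> z; rewrite permM !cycle_permE.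
move: Uxyc => /= /and3P[]; rewrite inE negb_or => /andP[xy x_c] y_c _ /=.
have [-> | zx] := eqVneq z x.
  rewrite tpermL.
  suff next_at_out x0 : y != x0 -> next_at y x x0 c = y.
    by rewrite next_at_out 1?eq_sym //.
  elim: c x0 {Uxc x_c} y_c => [|d c IHc] x0 /=.
    by move=> _ /negPf ->.
  rewrite inE negb_or => /andP[yd yc] /negPf ->.
  exact: IHc.
have [-> | zy] := eqVneq z y.
  by rewrite tpermR; case: c {Uxc x_c y_c} => [|d c] /=; rewrite !eqxx.
rewrite tpermD 1?eq_sym //.
by case: c {Uxc x_c y_c} => [|d c] /=; rewrite (negPf zx) (negPf zy).
Qed.

Lemma odd_cycle_perm (c : seq T) (Uc : uniq c) :
  0 < size c -> odd_perm (cycle_perm Uc) = ~~ odd (size c).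
Proof.
case: c Uc => // x c Uc _.
elim: c Uc => [|y c IHc] Uxyc.
  rewrite (_ : cycle_perm Uxyc = 1) ?odd_perm1 //.
  by apply/permP=> z; rewrite cycle_permE perm1 /=; case: eqP.
have Uxc : uniq (x :: c).
  by move: Uxyc; rewrite /= inE negb_or -andbA => /and4P[_ -> _ ->].
rewrite (cycle_perm_cons2 Uxyc Uxc) odd_permM odd_tperm IHc.
move: Uxyc; rewrite /= inE negb_or => /andP[/andP[-> _] _].
by rewrite addTb.
Qed.

Lemma cycle_perm_out (c : seq T) (Uc : uniq c) z i :
  z \notin c -> (cycle_perm Uc ^+ i) z = z.
Proof.
by move=> zc; apply: permX_fix; rewrite cycle_permE next_nth (negPf zc).
Qed.

Lemma cycle_perm_transitive (c : seq T) (Uc : uniq c) p q :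
  p \in c -> q \in c -> exists i, (cycle_perm Uc ^+ i) p = q.
Proof.
move=> pc qc; exists (findex (next c) p q).
rewrite permX (eq_iter (cycle_permE Uc)).
by apply: iter_findex; rewrite (fconnect_cycle (cycle_next Uc)).
Qed.

End PermutationGroups.

(** * Transpositions and parity on the board *)

Section Board.

Local Open Scope group_scope.

Variables m n : nat.
Hypotheses (m_gt1 : 1 < m) (n_gt1 : 1 < n).

Notation G := (magic_cube_group m n).

Lemma position_surj (k : 'I_(m * n)) : exists x y, k = position x y.
Proof.
have m_gt0 : 0 < m by apply: ltnW.
have x_lt : k %/ m < n by rewrite ltn_divLR // [X in _ < X]mulnC.
exists (Ordinal x_lt), (Ordinal (ltn_pmod k m_gt0)).
by apply: val_inj; rewrite /= [LHS](divn_eq k m) mulnC.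
Qed.

Lemma mem_column_cycle x y (i : 'I_m) :
  (position x y \in column_cycle n i) = (y == i).
Proof.
apply/mapP/eqP => [[x' _ /position_inj[]] // | ->].
by exists x; rewrite ?mem_rev ?mem_enum.
Qed.

Lemma mem_row_cycle x y (i : 'I_n) :
  (position x y \in row_cycle m i) = (x == i).
Proof.
apply/mapP/eqP => [[y' _ /position_inj[]] // | ->].
by exists y; rewrite ?mem_rev ?mem_enum.
Qed.

Lemma column_shift_in (i : 'I_m) : column_shift n i \in G.
Proof.
by apply/mem_gen/setUP; left; apply/bigcupP; exists i; rewrite ?cycle_id.
Qed.

Lemma row_shift_in (i : 'I_n) : row_shift m i \in G.
Proof.
by apply/mem_gen/setUP; right; apply/bigcupP; exists i; rewrite ?cycle_id.
Qed.

(** The commutator of powers of the shifts of row [x] and column [y], chosen to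
    send the corner [position x y] to the two other positions, is the product
    of the two transpositions. *)
Lemma corner_same_coset (x x' : 'I_n) (y y' : 'I_m) :
    x != x' -> y != y' ->
  tperm (position x y) (position x y') *: G =
  tperm (position x y) (position x' y) *: G.
Proof.
move=> xx' yy'; set p := position x y.
have [i Ri] : exists i, (row_shift m x ^+ i) p = position x y'.
  by apply: cycle_perm_transitive; rewrite mem_row_cycle.
have [j Cj] : exists j, (column_shift n y ^+ j) p = position x' y.
  by apply: cycle_perm_transitive; rewrite mem_column_cycle.
apply/eqP; rewrite lcoset_eqE tpermV -Ri -Cj -commutator_two_transpositions.
- by rewrite groupR ?groupX ?row_shift_in ?column_shift_in.
- move=> z; have [x1 [y1 ->]] := position_surj z.
  have [-> | x1x] := eqVneq x1 x.
    have [-> | y1y _] := eqVneq y1 y; first by rewrite eqxx.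
    by right; rewrite cycle_perm_out // mem_column_cycle.
  by left; rewrite cycle_perm_out // mem_row_cycle.
- by rewrite Ri; apply: contra_neq yy' => /position_inj[].
- by rewrite Cj; apply: contra_neq xx' => /position_inj[].
Qed.

Lemma exists_neq k (i : 'I_k) : 1 < k -> exists j, i != j.
Proof.
move=> k_gt1.
have /card_gt0P[j ij] : 0 < #|predC1 i| by rewrite cardC1 card_ord ltn_predRL.
by exists j; rewrite eq_sym.
Qed.

(** Two transpositions in row [x] sharing a position are compared through a
    transposition in the column of that position; two rows [x] and [x'] are
    compared through a transposition in a column, which makes a corner with
    both. *)
Lemma row_tperm_same_coset (x x' : 'I_n) (y z y' z' : 'I_m) :
    y != z -> y' != z' ->
  tperm (position x y) (position x z) *: G =
  tperm (position x' y') (position x' z') *: G.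
Proof.
have pivot x0 (a b b' : 'I_m) : a != b -> a != b' ->
    tperm (position x0 a) (position x0 b) *: G =
    tperm (position x0 a) (position x0 b') *: G.
  have [x1 x01] := exists_neq x0 n_gt1 => ab ab'.
  by rewrite !(corner_same_coset x01).
have same_row : y != z -> y' != z' ->
    tperm (position x y) (position x z) *: G =
    tperm (position x y') (position x z') *: G.
  have [<- | yy' yz yz'] := eqVneq y y'; first exact: pivot.
  by rewrite (pivot _ _ _ _ yz yy') tpermC; apply: pivot; rewrite // eq_sym.
move=> yz yz'; rewrite same_row //.
have [<- // | xx'] := eqVneq x x'.
rewrite (corner_same_coset xx' yz') tpermC.
by rewrite -(corner_same_coset _ yz') 1?eq_sym.
Qed.

Lemma Alt_sub_magic_cube_group : 'Alt_('I_(m * n)) \subset G.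
Proof.
pose x0 : 'I_n := Ordinal (ltnW n_gt1); pose y0 : 'I_m := Ordinal (ltnW m_gt1).
have [y1 y01] := exists_neq y0 m_gt1.
apply: (@Alt_sub_one_coset _ _ (tperm (position x0 y0) (position x0 y1))).
have row x y y' : y != y' -> tperm (position x y) (position x y') *: G =
    tperm (position x0 y0) (position x0 y1) *: G.
  by move=> yy'; apply: row_tperm_same_coset.
have col x x' y : x != x' -> tperm (position x y) (position x' y) *: G =
    tperm (position x0 y0) (position x0 y1) *: G.
  have [y' yy'] := exists_neq y m_gt1.
  by move=> xx'; rewrite -(corner_same_coset xx' yy') row.
move=> a b.
have [x [y ->]] := position_surj a; have [x' [y' ->]] := position_surj b.
have [-> | xx'] := eqVneq x x'.
  have [-> | yy' _] := eqVneq y y'; first by rewrite eqxx.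
  exact: row.
have [-> | yy' ab] := eqVneq y y'; first by rewrite col.
(* Go through the position in the row of [a] and the column of [b]. *)
rewrite (@lcoset_tperm_trans _ _ _ _ (position x y')) ?row ?col //.
  by apply: contra_neq yy' => /position_inj[].
by apply: contra_neq xx' => /position_inj[].
Qed.

Lemma odd_column_shift (i : 'I_m) : odd_perm (column_shift n i) = ~~ odd n.
Proof.
by rewrite odd_cycle_perm size_map size_rev size_enum_ord // ltnW.
Qed.

Lemma odd_row_shift (i : 'I_n) : odd_perm (row_shift m i) = ~~ odd m.
Proof.
by rewrite odd_cycle_perm size_map size_rev size_enum_ord // ltnW.
Qed.

Lemma magic_cube_group_sub_Alt :
  odd m -> odd n -> G \subset 'Alt_('I_(m * n)).
Proof.
move=> odd_m odd_n; rewrite gen_subG subUset.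
apply/andP; split; apply/bigcupsP=> i _; rewrite cycle_subG Alt_even.
  by rewrite odd_column_shift odd_n.
by rewrite odd_row_shift odd_m.
Qed.

Lemma odd_perm_in_magic_cube_group :
  ~~ odd (m * n) -> exists2 s, s \in G & odd_perm s.
Proof.
rewrite oddM negb_and => /orP[even_m | even_n].
  exists (row_shift m (Ordinal (ltnW n_gt1))); first exact: row_shift_in.
  by rewrite odd_row_shift.
exists (column_shift n (Ordinal (ltnW m_gt1))); first exact: column_shift_in.
by rewrite odd_column_shift.
Qed.

End Board.

Theorem theorem5p2p4 (m n : nat) (hn : 2 <= n) (hmn : n < m) :
  #|magic_cube_group m n| =
    if odd (m * n) then (m * n)`! %/ 2 else (m * n)`!.
Proof.
have m_gt1 : 1 < m by apply: ltn_trans hmn.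
have AltG := Alt_sub_magic_cube_group m_gt1 hn.
case: ifPn => [odd_mn | even_mn].
  have [odd_m odd_n] : odd m /\ odd n by apply/andP; rewrite -oddM.
  have -> : magic_cube_group m n = ('Alt_('I_(m * n)))%g :> {set _}.
    by apply/eqP; rewrite eqEsubset AltG magic_cube_group_sub_Alt.
  have mn_gt1 : 1 < #|'I_(m * n)|.
    by rewrite card_ord (leq_trans m_gt1) // leq_pmulr // ltnW.
  by rewrite -[in RHS](card_ord (m * n)) -(card_Alt mn_gt1) mulKn.
have [s Gs odd_s] := odd_perm_in_magic_cube_group m_gt1 hn even_mn.
rewrite (eq_setT_Alt_sub_odd AltG Gs odd_s).
by rewrite -[in RHS](card_ord (m * n)) -card_Sym.
Qed.
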